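(* Let $(K,v)$ be a maximal field of characteristic $0$ and let $(L|K,v)$ be an algebraic extension of valued fields. Then $(L,v)$ is maximal if and only if $L|K$ is a finite extension.
   Context: For a valued field $(K,v)$ (Krull valuation), $vK$ denotes the value group and $Kv$ the residue field. In a valued field extension $(L|K,v)$, $K$ carries the restriction of $v$ from $L$. The extension is immediate if the canonical embeddings $vK\hookrightarrow vL$ and $Kv\hookrightarrow Lv$ are onto. A valued field is maximal if it admits no proper immediate extension. ''Characteristic $0$'' refers to the field $K$.
   Formalization: The valuation on K is additionally assumed nontrivial; the claim fails for trivial valuations, since a trivially valued field is always maximal (e.g. K = Q and L its algebraic closure, both trivially valued: L is maximal but L|K is infinite). *)

(* Defs.v *)
From HB Require Import structures.
From mathcomp Require Import all_boot all_order all_algebra.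

Set Implicit Arguments.
Unset Strict Implicit.
Unset Printing Implicit Defensive.

Import Order.TTheory GRing.Theory.
Local Open Scope ring_scope.
Local Open Scope quotient_scope.

(* Totally ordered abelian groups, of arbitrary rank. Totality is an axiom     *)
(* rather than a join with Order.Total, which the hierarchy does not allow     *)
(* once Num.RealDomain is declared.                                            *)
HB.mixin Record POrderedZmodule_isOrderedGroup G of Num.POrderedZmodule G := {
  oag_total : total (<=%R : rel G);
  oag_lerD2l : forall z x y : G, x <= y -> z + x <= z + y
}.

#[short(type="oagType")]
HB.structure Definition OrderedGroup :=
  { G of POrderedZmodule_isOrderedGroup G & Num.POrderedZmodule G }.

(* [option G] is the group G with a top element [None] = oo adjoined. *)
Section ExtendedGroup.
Variable G : oagType.
Implicit Types a b : option G.

Definition vadd a b : option G :=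
  if a is Some x then if b is Some y then Some (x + y) else None else None.

Definition vle a b : bool :=
  if b is Some y then if a is Some x then x <= y else false else true.

Definition vlt a b : bool := ~~ vle b a.

Definition vmin a b : option G := if vle a b then a else b.

End ExtendedGroup.

(* Krull valuations, written additively. By [val_onto] the group G is the      *)
(* value group vK. The trivial valuation (G = 0) is allowed.                   *)
Record valuation (K : fieldType) (G : oagType) := Valuation {
  val_fun :> K -> option G;
  val_eq_oo : forall x, val_fun x = None <-> x = 0;
  val_mul : forall x y, val_fun (x * y) = vadd (val_fun x) (val_fun y);
  val_add : forall x y, vle (vmin (val_fun x) (val_fun y)) (val_fun (x + y));
  val_onto : forall g : G, exists x, val_fun x = Some g
}.

(* A trivially valued field is always maximal, in particular every algebraic   *)
(* extension of it is, finite or not.                                          *)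
Definition nontrivial (K : fieldType) (G : oagType) (v : valuation K G) : Prop :=
  exists2 x : K, x != 0 & v x != Some 0.

Section OrderedGroupTheory.
Variable G : oagType.

Lemma oag_leNgt (x y : G) : (x <= y) = ~~ (y < x).
Proof. by apply: comparable_leNgt; exact: oag_total. Qed.

Lemma oag_ltNge (x y : G) : (x < y) = ~~ (y <= x).
Proof. by rewrite oag_leNgt negbK. Qed.

Lemma oag_lerD (x y z t : G) : x <= y -> z <= t -> x + z <= y + t.
Proof.
move=> xy zt; apply: (le_trans (oag_lerD2l x _ _ zt)).
by rewrite addrC [y + t]addrC; exact: oag_lerD2l.
Qed.

Lemma oag_ltrD (x y : G) : 0 < x -> 0 <= y -> 0 < x + y.
Proof.
by move=> x0 y0; apply: (lt_le_trans x0); have := oag_lerD2l x _ _ y0; rewrite addr0.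
Qed.

Lemma oag_double_eq0 (x : G) : x + x = 0 -> x = 0.
Proof.
move=> xx; apply/eqP; rewrite eq_le; apply/andP; split.
  by rewrite oag_leNgt; apply/negP => h; have := oag_ltrD h (ltW h); rewrite xx ltxx.
rewrite oag_leNgt; apply/negP => h.
have := oag_lerD2l x _ _ (ltW h); rewrite xx addr0 => h'.
by have := lt_le_trans h h'; rewrite ltxx.
Qed.

End OrderedGroupTheory.

Section ResidueField.
Variables (K : fieldType) (G : oagType) (v : valuation K G).

Lemma val0 : v 0 = None. Proof. by apply/val_eq_oo. Qed.

Lemma val_neq0 x : x != 0 -> exists g, v x = Some g.
Proof.
move=> x0; case E: (v x) => [g|]; first by exists g.
by move/val_eq_oo: E x0 => ->; rewrite eqxx.
Qed.

Lemma val1 : v 1 = Some 0.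
Proof.
have [g vg] := val_neq0 (oner_neq0 K); have := val_mul v 1 1.
by rewrite mulr1 vg /= => -[/eqP]; rewrite -subr_eq0 opprD addNKr oppr_eq0 => /eqP ->.
Qed.

Lemma valN1 : v (-1) = Some 0.
Proof.
have n0 : (-1 : K) != 0 by rewrite oppr_eq0 oner_neq0.
have [g vg] := val_neq0 n0; have := val_mul v (-1) (-1).
by rewrite mulrNN mulr1 val1 vg /= => -[/esym /oag_double_eq0 ->].
Qed.

Lemma valN x : v (- x) = v x.
Proof. by rewrite -mulN1r val_mul valN1; case: (v x) => //= g; rewrite add0r. Qed.

Lemma val_inv x : v x = Some 0 -> v x^-1 = Some 0.
Proof.
move=> vx; have x0 : x != 0 by apply/eqP => x0; rewrite x0 val0 in vx.
by have := val_mul v x x^-1; rewrite divff // val1 vx; case: (v _) => //= g; rewrite add0r.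
Qed.

Definition valring_pred : {pred K} := [pred x | vle (Some 0) (v x)].

Lemma valring_closed : subring_closed valring_pred.
Proof.
split=> [|x y|x y]; rewrite !inE.
- by rewrite val1 /= lexx.
- rewrite -(valN y) => hx hy; have := val_add v x (- y); rewrite /vmin; case: ifP => _.
    by move: hx; case: (v x) => [?|]; case: (v (x - y)) => [?|] //=; exact: le_trans.
  by move: hy; case: (v (- y)) => [?|]; case: (v (x - y)) => [?|] //=; exact: le_trans.
- rewrite val_mul; case: (v x) => [?|]; case: (v y) => [?|] //= hx hy.
  by have := oag_lerD hx hy; rewrite addr0.
Qed.

HB.instance Definition _ := GRing.isSubringClosed.Build K valring_pred valring_closed.

(* The valuation ring O_v = {x | v x >= 0}. *)
Record valring := ValRing { valring_val :> K; _ : valring_val \in valring_pred }.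
HB.instance Definition _ := [isSub for valring_val].
HB.instance Definition _ := [Choice of valring by <:].
HB.instance Definition _ := [SubChoice_isSubComNzRing of valring by <:].

(* The maximal ideal M_v = {x | v x > 0} of O_v. *)
Definition maxideal : {pred valring} := [pred x : valring | vlt (Some 0) (v (val x))].

Lemma maxideal_closed : idealr_closed maxideal.
Proof.
split; rewrite ?inE /vlt.
- by rewrite val0.
- by rewrite val1 /= lexx.
move=> a x y hx hy; rewrite inE.
have {}hx : vlt (Some 0) (v (val x)) by [].
have {}hy : vlt (Some 0) (v (val y)) by [].
rewrite rmorphD rmorphM.
have ha := valP a; rewrite inE in ha.
have hax : vlt (Some 0) (v (val a * val x)).
  rewrite val_mul /vlt; move: ha hx.
  case: (v (val a)) => [g|]; case: (v (val x)) => [h|] //=.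
  by rewrite /vlt /= -!oag_ltNge addrC => g0 h0; exact: oag_ltrD.
have := val_add v (val a * val x) (val y); rewrite /vmin.
move: hax hy; rewrite /vlt; case: ifP => _.
  case: (v (val a * val x)) => [?|]; case: (v (_ + _)) => [?|] //=.
  by rewrite -!oag_ltNge => h _; exact: lt_le_trans.
move=> _; case: (v (val y)) => [?|]; case: (v (_ + _)) => [?|] //=.
by rewrite -!oag_ltNge; exact: lt_le_trans.
Qed.

HB.instance Definition _ := isIdealr.Build valring maxideal maxideal_closed.

(* The residue field Kv = O_v / M_v, with canonical projection [residue_pi].   *)
Definition residue : Type := {ideal_quot maxideal}.
HB.instance Definition _ := GRing.ComNzRing.on residue.

Definition residue_pi (x : valring) : residue := \pi_({ideal_quot maxideal}) x.

Lemma residue_pi_zmod : zmod_morphism residue_pi.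
Proof. by move=> x y; rewrite /residue_pi rmorphB. Qed.
Lemma residue_pi_monoid : monoid_morphism residue_pi.
Proof. by split=> [|x y]; rewrite /residue_pi ?rmorph1 ?rmorphM. Qed.
HB.instance Definition _ :=
  GRing.isZmodMorphism.Build valring residue residue_pi residue_pi_zmod.
HB.instance Definition _ :=
  GRing.isMonoidMorphism.Build valring residue residue_pi residue_pi_monoid.

Definition residue_repr (r : residue) : valring := repr (r : {ideal_quot maxideal}).

Lemma residue_reprK r : residue_pi (residue_repr r) = r.
Proof. exact: reprK. Qed.

Lemma residue_piE x y : (residue_pi x == residue_pi y) = (x - y \in maxideal).
Proof. by rewrite Quotient.idealrBE eqmodE. Qed.

Lemma residue_pi_eq0 x : (residue_pi x == 0) = (x \in maxideal).
Proof. by rewrite -(rmorph0 residue_pi) residue_piE subr0. Qed.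

Lemma valring_unit (x : valring) : x \notin maxideal -> v (val x) = Some 0.
Proof.
rewrite inE /vlt negbK; have := valP x; rewrite inE.
case: (v (val x)) => [g|] //= g0 g0'; congr Some.
by apply/eqP; rewrite eq_le g0 g0'.
Qed.

Definition residue_inv (r : residue) : residue :=
  let x := residue_repr r in
  if r == 0 then 0 else residue_pi (insubd (0 : valring) (val x)^-1).

Lemma residue_mulVf (r : residue) : r != 0 -> residue_inv r * r = 1.
Proof.
move=> r0; rewrite /residue_inv (negbTE r0) -[X in _ * X]residue_reprK -rmorphM.
have : residue_repr r \notin maxideal by rewrite -residue_pi_eq0 residue_reprK.
move/valring_unit => vx; have vx' := val_inv vx.
rewrite -[RHS](rmorph1 residue_pi); congr residue_pi; apply: val_inj.
rewrite rmorphM rmorph1 /= insubdK ?inE ?vx' ?lexx //= mulVf //.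
by apply/eqP => x0; move: vx; rewrite /= x0 val0.
Qed.

Lemma residue_inv0 : residue_inv 0 = 0.
Proof. by rewrite /residue_inv eqxx. Qed.

HB.instance Definition _ :=
  GRing.ComNzRing_isField.Build residue residue_mulVf residue_inv0.

End ResidueField.

(* (L|K, v): an embedding of K in L, through which the valuation of K is the   *)
(* restriction of that of L. As v and w are onto, [ext_group] is uniquely      *)
(* determined by the field embedding: it is the canonical embedding vK -> vL.  *)
Record valued_extension (K L : fieldType) (G H : oagType)
    (v : valuation K G) (w : valuation L H) := ValuedExtension {
  ext_field :> {rmorphism K -> L};
  ext_group : {additive G -> H};
  ext_group_mono : {mono ext_group : x y / x <= y};
  ext_val : forall x, w (ext_field x) = omap ext_group (v x)
}.

Section ResidueEmbedding.
Variables (K L : fieldType) (G H : oagType).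
Variables (v : valuation K G) (w : valuation L H) (E : valued_extension v w).

Lemma ext_valring (x : valring v) : ext_field E (val x) \in valring_pred w.
Proof.
rewrite inE ext_val; have := valP x; rewrite inE.
by case: (v _) => //= g g0; rewrite -(raddf0 (ext_group E)) ext_group_mono.
Qed.

Definition ext_ring (x : valring v) : valring w := ValRing (ext_valring x).

(* The canonical embedding Kv -> Lv. *)
Definition ext_residue (r : residue v) : residue w :=
  residue_pi (ext_ring (residue_repr r)).

Lemma ext_residueE (x : valring v) : ext_residue (residue_pi x) = residue_pi (ext_ring x).
Proof.
apply/eqP; rewrite residue_piE; set y := residue_repr _.
have : residue_pi y == residue_pi x by rewrite residue_reprK.
rewrite residue_piE !inE /vlt.
rewrite !rmorphB /= -rmorphB ext_val; case: (v _) => //= g.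
by rewrite -(raddf0 (ext_group E)) ext_group_mono.
Qed.

Lemma ext_residue_zmod : zmod_morphism ext_residue.
Proof.
move=> r s; rewrite -(residue_reprK r) -(residue_reprK s) -rmorphB !ext_residueE.
by rewrite -rmorphB; congr residue_pi; apply: val_inj; rewrite /= !rmorphB.
Qed.

Lemma ext_residue_monoid : monoid_morphism ext_residue.
Proof.
split=> [|r s].
  rewrite -(rmorph1 (@residue_pi _ _ v)) ext_residueE -[RHS](rmorph1 (@residue_pi _ _ w)).
  by congr residue_pi; apply: val_inj; rewrite /= !rmorph1.
rewrite -(residue_reprK r) -(residue_reprK s) -rmorphM !ext_residueE.
by rewrite -rmorphM; congr residue_pi; apply: val_inj; rewrite /= !rmorphM.
Qed.

HB.instance Definition _ := GRing.isZmodMorphism.Build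
  (residue v) (residue w) ext_residue ext_residue_zmod.
HB.instance Definition _ := GRing.isMonoidMorphism.Build
  (residue v) (residue w) ext_residue ext_residue_monoid.

End ResidueEmbedding.

Definition immediate (K L : fieldType) (G H : oagType)
    (v : valuation K G) (w : valuation L H) (E : valued_extension v w) : Prop :=
  (forall h : H, exists g : G, ext_group E g = h) /\
  (forall s : residue w, exists r : residue v, ext_residue E r = s).

(* No proper immediate extension: every immediate extension is trivial. *)
Definition maximal (K : fieldType) (G : oagType) (v : valuation K G) : Prop :=
  forall (L : fieldType) (H : oagType) (w : valuation L H)
    (E : valued_extension v w),
  immediate E -> forall y : L, exists x : K, ext_field E x = y.

Definition algebraic_extension (K L : fieldType) (f : {rmorphism K -> L}) : Prop :=
  forall y : L, algebraicOver f y.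

(* L has a finite basis b_0, ..., b_(n-1) as a K-vector space. *)
Definition finite_extension (K L : fieldType) (f : {rmorphism K -> L}) : Prop :=
  exists (n : nat) (b : 'I_n -> L), forall y : L,
    exists! c : 'rV[K]_n, y = \sum_(i < n) f (c 0 i) * b i.

(* Main.v *)
(* A family of nested balls in [K] with empty intersection yields a proper
   immediate extension of [K] (Kaplansky), so a maximal field is spherically
   complete. Best approximations then show by induction on the dimension that
   a finite-dimensional [K]-subspace of a valued field extension is spherically
   complete, provided [K] is. Hence a finite extension [L] of [K] is a
   spherically complete subset of any immediate extension [M] of [L]; a best
   approximation in [L] of an element of [M] must be equal to it, as otherwise
   immediacy would improve it.

   Conversely, an algebraic extension of characteristic 0 whose elements have
   bounded degree is finite, by the primitive element theorem. If the degrees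
   are unbounded, the sets of elements of degree greater than [n] are dense in
   [L], and open because finite free families have bounded coordinates; a
   nested sequence of balls in these sets has a common point if [L] is maximal,
   and this point is transcendental over [K]. *)

Require Import Defs.
From HB Require Import structures.
From mathcomp Require Import all_boot all_order all_algebra all_field.
From mathcomp Require Import boolp zify.
Set Implicit Arguments.
Unset Strict Implicit.
Unset Printing Implicit Defensive.

Import Order.TTheory GRing.Theory.
Local Open Scope ring_scope.

(** * Ordered arithmetic with oo and ultrametric inequalities *)

Section ExtendedGroupTheory.
Variable G : oagType.
Implicit Types a b c d : option G.

Lemma vle_refl a : vle a a.
Proof. by case: a => //= x; rewrite lexx. Qed.

Lemma vle_trans b a c : vle a b -> vle b c -> vle a c.
Proof. by case: a b c => [x|] [y|] [z|] //=; exact: le_trans. Qed.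

Lemma vle_anti a b : vle a b -> vle b a -> a = b.
Proof.
by case: a b => [x|] [y|] //= xy yx; congr Some; apply/eqP; rewrite eq_le xy.
Qed.

Lemma vleNgt a b : vle a b = ~~ vlt b a.
Proof. by rewrite /vlt negbK. Qed.

Lemma vle_total a b : vle a b || vle b a.
Proof. by case: a b => [x|] [y|] //=; exact: oag_total. Qed.

Lemma vltW a b : vlt a b -> vle a b.
Proof. by rewrite /vlt; case/orP: (vle_total a b) => -> //. Qed.

Lemma vlt_le_trans b a c : vlt a b -> vle b c -> vlt a c.
Proof. by move=> ab bc; apply: contra ab; exact: vle_trans. Qed.

Lemma vle_lt_trans b a c : vle a b -> vlt b c -> vlt a c.
Proof. by move=> ab bc; apply: contra bc => ca; exact: vle_trans ab. Qed.

Lemma vlt_irrefl a : vlt a a = false.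
Proof. by rewrite /vlt vle_refl. Qed.

Lemma vaddC a b : vadd a b = vadd b a.
Proof. by case: a b => [x|] [y|] //=; rewrite addrC. Qed.

Lemma vaddA a b c : vadd a (vadd b c) = vadd (vadd a b) c.
Proof. by case: a b c => [x|] [y|] [z|] //=; rewrite addrA. Qed.

Lemma vle_add2r c a b : vle a b -> vle (vadd a c) (vadd b c).
Proof.
by case: a b c => [x|] [y|] [z|] //= xy; rewrite ![_ + z]addrC; exact: oag_lerD2l.
Qed.

Lemma vle_add a b c d : vle a b -> vle c d -> vle (vadd a c) (vadd b d).
Proof.
move=> ab cd; apply: (vle_trans (vle_add2r c ab)).
by rewrite ![vadd b _]vaddC; exact: vle_add2r.
Qed.

Lemma vlt_add2r (g : G) a b : vlt (vadd a (Some g)) (vadd b (Some g)) = vlt a b.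
Proof.
have K c : vadd (vadd c (Some g)) (Some (- g)) = c.
  by rewrite -vaddA /= subrr; case: c => //= x; rewrite addr0.
congr negb; apply/idP/idP; last exact: vle_add2r.
by move/(vle_add2r (Some (- g))); rewrite !K.
Qed.

Lemma vle_add2rE (g : G) a b : vle (vadd a (Some g)) (vadd b (Some g)) = vle a b.
Proof. by rewrite !vleNgt vlt_add2r. Qed.

Lemma vlt_Some a b : vlt a b -> exists g, a = Some g.
Proof. by case: a => [g|]; [exists g | rewrite /vlt; case: b]. Qed.

Lemma vlt_le_add a b c d : vlt a b -> vle c d -> c <> None ->
  vlt (vadd a c) (vadd b d).
Proof.
case: c => // z ab cd _; apply: (@vlt_le_trans (vadd b (Some z))).
  by rewrite vlt_add2r.
by apply: vle_add => //; exact: vle_refl.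
Qed.

End ExtendedGroupTheory.

Section ValuationTheory.
Variables (K : fieldType) (G : oagType) (v : valuation K G).
Implicit Types (x y : K) (a : option G).

Lemma val_addge a x y : vle a (v x) -> vle a (v y) -> vle a (v (x + y)).
Proof. by move=> ax ay; apply: vle_trans (val_add v x y); rewrite /vmin; case: ifP. Qed.

Lemma val_subge a x y : vle a (v x) -> vle a (v y) -> vle a (v (x - y)).
Proof. by move=> ax ay; apply: val_addge; rewrite ?valN. Qed.

Lemma val_addgt a x y : vlt a (v x) -> vlt a (v y) -> vlt a (v (x + y)).
Proof.
move=> ax ay; apply: vlt_le_trans (val_add v x y); rewrite /vmin; case: ifP => //.
Qed.

Lemma val_subgt a x y : vlt a (v x) -> vlt a (v y) -> vlt a (v (x - y)).
Proof. by move=> ax ay; apply: val_addgt; rewrite ?valN. Qed.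

Lemma val_distC x y : v (x - y) = v (y - x).
Proof. by rewrite -valN opprB. Qed.

Lemma val_near x y : vlt (v x) (v (x - y)) -> v y = v x.
Proof.
move=> h; have -> : y = x - (x - y) by rewrite opprB addrC subrK.
apply/esym/vle_anti; first by apply: val_subge; [exact: vle_refl | exact: vltW].
rewrite vleNgt; apply/negP => h'; have := val_addgt h' h.
by rewrite subrK vlt_irrefl.
Qed.

Lemma val_sum_ge a I (r : seq I) (P : pred I) (F : I -> K) :
  (forall i, P i -> vle a (v (F i))) -> vle a (v (\sum_(i <- r | P i) F i)).
Proof.
move=> h; elim/big_ind: _ => //; last by move=> ? ?; exact: val_addge.
by rewrite val0; case: a h.
Qed.

End ValuationTheory.

(** * Germs along a proper filter [near] and the valuation they induce *)

Section Germs.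
Variables (K : fieldType) (G : oagType) (v : valuation K G).
Variable near : (K -> Prop) -> Prop.
Hypothesis near_sub : forall A B : K -> Prop, near A -> (forall y, A y -> B y) -> near B.
Hypothesis near_and : forall A B : K -> Prop, near A -> near B -> near (fun y => A y /\ B y).
Hypothesis near_true : near (fun=> True).
Hypothesis near_ex : forall A, near A -> exists y, A y.
Implicit Types f g : K -> K.

(* The leading term of [f] is eventually constant along the filter. This is
   stronger than [v (f y)] being eventually constant. *)
Definition stable f := exists2 A, near A &
  forall y z, A y -> A z -> vlt (v (f y)) (v (f y - f z)).

Lemma stable_ext f g : near (fun y => f y = g y) -> stable f -> stable g.
Proof.
move=> e [A nA hA]; exists (fun y => A y /\ f y = g y); first exact: near_and.
by move=> y z [Ay <-] [Az <-]; exact: hA.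
Qed.

Lemma stable_neq0 f : stable f -> near (fun y => f y <> 0).
Proof.
move=> [A nA hA]; apply: near_sub nA _ => y Ay fy0.
by have := hA _ _ Ay Ay; rewrite fy0 val0 /vlt; case: (v _).
Qed.

Lemma stable_val f : stable f -> exists g : G, near (fun y => v (f y) = Some g).
Proof.
move=> [A nA hA]; have [y Ay] := near_ex nA.
have [g fg] := vlt_Some (hA _ _ Ay Ay); exists g.
by apply: near_sub nA _ => z Az; rewrite -fg; exact/val_near/hA.
Qed.

Lemma stable_cst (c : K) : c != 0 -> stable (fun=> c).
Proof.
move=> c0; exists (fun=> True) => // y z _ _; rewrite subrr val0.
by have [g ->] := val_neq0 v c0.
Qed.

Lemma stable_mul f g : stable f -> stable g -> stable (fun y => f y * g y).
Proof.
move=> [A nA hA] [B nB hB]; exists (fun y => A y /\ B y); first exact: near_and.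
move=> y z [Ay By] [Az Bz].
have -> : f y * g y - f z * g z = (f y - f z) * g z + f y * (g y - g z).
  by rewrite mulrBl mulrBr [RHS]addrC addrA subrK.
have fyN : v (f y) <> None by have [? ->] := vlt_Some (hA _ _ Ay Ay).
have gyN : v (g y) <> None by have [? ->] := vlt_Some (hB _ _ By By).
rewrite !val_mul; apply: val_addgt; rewrite !val_mul.
  by apply: vlt_le_add; rewrite ?(val_near (hB _ _ By Bz)) ?vle_refl //; exact: hA.
by rewrite ![vadd (v (f y)) _]vaddC; apply: vlt_le_add (hB _ _ _ _) (vle_refl _) _.
Qed.

Lemma stable_inv f : stable f -> stable (fun y => (f y)^-1).
Proof.
move=> sf; have nf := stable_neq0 sf; case: sf => A nA hA.
exists (fun y => A y /\ f y <> 0); first exact: near_and.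
move=> y z [Ay /eqP fy0] [Az /eqP fz0].
have [a va] := val_neq0 v fy0; have [b vb] := val_neq0 v fz0.
(* Adding [v (f y)] and [v (f z)] to both sides leaves [v (f z)], equal to [v (f y)], against
   [v (f z - f y)]. *)
rewrite -(vlt_add2r a) -(vlt_add2r b) -va -vb -!val_mul mulVf // mul1r.
rewrite (val_near (hA _ _ Ay Az)) mulrBl mulVf // mulrBl mul1r -mulrA.
by rewrite [f y * f z]mulrC mulKf // val_distC; exact: hA.
Qed.

Lemma stable_cancell f g :
  stable f -> stable (fun y => f y * g y) -> stable g.
Proof.
move=> sf sfg; apply: stable_ext (stable_mul (stable_inv sf) sfg).
by apply: near_sub (stable_neq0 sf) _ => y /eqP fy0; rewrite mulKf.
Qed.

(** If the leading terms of [f] and [g] agree at one point of [A] and [B], stability carries the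
    agreement to all such points. Otherwise [v (f y - g y)] is at most [v (f y)] and [v (g y)],
    hence below the variation of both. *)
Lemma stable_sub f g : stable f -> stable g ->
  near (fun y => vlt (v (f y)) (v (f y - g y))) \/ stable (fun y => f y - g y).
Proof.
move=> [A nA hA] [B nB hB].
have nAB : near (fun y => A y /\ B y) by exact: near_and.
have [[y0 [[Ay0 By0] h0]]|h] :=
  pselect (exists y, (A y /\ B y) /\ vlt (v (f y)) (v (f y - g y))); [left|right].
  apply: near_sub nAB _ => y [Ay By].
  have -> : f y - g y = (f y - f y0) + (f y0 - g y0) + (g y0 - g y).
    by rewrite !subrKA.
  have e := val_near (hA _ _ Ay0 Ay); rewrite e.
  apply: val_addgt; first apply: val_addgt => //.
    by rewrite val_distC; exact: hA.
  by rewrite -(val_near h0); exact: hB.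
exists (fun y => A y /\ B y) => // y z [Ay By] [Az Bz].
have le_f : vle (v (f y - g y)) (v (f y)).
  by rewrite vleNgt; apply/negP => hy; apply: h; exists y.
have le_g : vle (v (f y - g y)) (v (g y)).
  have {2}-> : g y = f y - (f y - g y) by rewrite opprB addrC subrK.
  exact: val_subge (vle_refl _).
have -> : f y - g y - (f z - g z) = f y - f z - (g y - g z).
  by rewrite !opprB addrACA [RHS]addrACA; congr (_ + _); rewrite addrC.
by apply: val_subgt; [apply: vle_lt_trans (hA _ _ Ay Az) | apply: vle_lt_trans (hB _ _ By Bz)].
Qed.

(* Valuation of a field [F] whose elements [z] have germs [ev z], that are
   only required to be multiplicative up to terms of higher value. *)
Section GermField.
Variables (F : fieldType) (phi : {rmorphism K -> F}) (ev : F -> K -> K).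
Hypothesis ev_stable : forall z : F, z != 0 -> stable (ev z).
Hypothesis ev_phi : forall x, near (fun y => ev (phi x) y = x).
Hypothesis ev_add : forall z t, near (fun y => ev (z + t) y = ev z y + ev t y).
Hypothesis ev_mul : forall z t : F, z != 0 -> t != 0 ->
  near (fun y => vlt (v (ev z y * ev t y)) (v (ev z y * ev t y - ev (z * t) y))).

Lemma germ_val_ex z : exists a : option G, near (fun y => v (ev z y) = a).
Proof.
have [->|z0] := eqVneq z 0.
  exists None; apply: near_sub (ev_phi 0) _ => y; rewrite rmorph0 => ->; exact: val0.
by have [g hg] := stable_val (ev_stable z0); exists (Some g).
Qed.

Definition germ_val z : option G := sval (cid (germ_val_ex z)).

Lemma germ_valP z : near (fun y => v (ev z y) = germ_val z).
Proof. exact: svalP (cid (germ_val_ex z)). Qed.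

Lemma germ_valE z (a : option G) : near (fun y => v (ev z y) = a) -> germ_val z = a.
Proof.
by move=> ng; have [y [<- <-]] := near_ex (near_and (germ_valP z) ng).
Qed.

Lemma germ_val_phi x : germ_val (phi x) = v x.
Proof. by apply: germ_valE; apply: near_sub (ev_phi x) _ => y ->. Qed.

Lemma germ_val_eq_oo z : germ_val z = None <-> z = 0.
Proof.
split=> [|->]; last by rewrite -(rmorph0 phi) germ_val_phi val0.
move=> zN; apply/eqP; apply: contraPT zN => /ev_stable/stable_val[g hg].
by rewrite (germ_valE hg).
Qed.

Lemma germ_val_mul z t : germ_val (z * t) = vadd (germ_val z) (germ_val t).
Proof.
have v00 : germ_val 0 = None by apply/germ_val_eq_oo.
have [->|z0] := eqVneq z 0; first by rewrite mul0r v00.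
have [->|t0] := eqVneq t 0; first by rewrite mulr0 v00; case: germ_val.
have [y [[<- <-] h]] := near_ex (near_and (near_and (germ_valP z) (germ_valP t))
  (near_and (germ_valP (z * t)) (ev_mul z0 t0))).
by case: h => <- /val_near ->; rewrite val_mul.
Qed.

Lemma germ_val_add z t : vle (vmin (germ_val z) (germ_val t)) (germ_val (z + t)).
Proof.
have [y [[<- <-] h]] := near_ex (near_and (near_and (germ_valP z) (germ_valP t))
  (near_and (germ_valP (z + t)) (ev_add z t))).
by case: h => <- ->; exact: val_add.
Qed.

Lemma germ_val_onto (g : G) : exists z, germ_val z = Some g.
Proof. by have [x vx] := val_onto v g; exists (phi x); rewrite germ_val_phi. Qed.

Definition germ_valuation : valuation F G :=
  Valuation germ_val_eq_oo germ_val_mul germ_val_add germ_val_onto.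

Lemma germ_valued_ext_val x : germ_valuation (phi x) = omap idfun (v x).
Proof. by rewrite /= germ_val_phi; case: (v x). Qed.

Definition germ_extension : valued_extension v germ_valuation :=
  @ValuedExtension _ _ _ _ _ _ phi (idfun : {additive G -> G})
    (fun x y => erefl) germ_valued_ext_val.

(** The value group does not grow by construction. A residue represented by [z] of value 0 is also
    that of the constant [ev z y] for a suitable [y], since by stability [ev z] varies there only by
    terms of positive value. *)
Lemma germ_immediate : immediate germ_extension.
Proof.
split=> [h|s]; first by exists h.
have [->|s0] := eqVneq s 0; first by exists 0; rewrite rmorph0.
have [z sz] : exists z, residue_pi z = s by exists (residue_repr s); exact: residue_reprK.
have vz : germ_valuation (val z) = Some 0.
  by apply: valring_unit; rewrite -residue_pi_eq0 sz.
have z0 : val z != 0 by apply/eqP => e; rewrite e val0 in vz.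
have [A nA hA] := ev_stable z0.
have [y [Ay vy]] := near_ex (near_and nA (germ_valP (val z))).
have xO : ev (val z) y \in valring_pred v.
  by rewrite inE vy -[germ_val _]/(germ_valuation _) vz vle_refl.
exists (residue_pi (ValRing xO)); rewrite ext_residueE -sz.
apply/eqP; rewrite eq_sym residue_piE inE rmorphB /=.
have [t [e [[At Et] hp]]] := near_ex (near_and
    (germ_valP (val z - phi (ev (val z) y))) (near_and (near_and nA
   (ev_add (val z) (- phi (ev (val z) y)))) (ev_phi (- ev (val z) y)))).
rewrite -e Et -rmorphN hp.
have := hA _ _ Ay At; rewrite val_distC vy -[germ_val _]/(germ_valuation _) vz.
by [].
Qed.

Lemma germ_onto : maximal v -> forall z, exists x, phi x = z.
Proof. by move=> mv; exact: (mv _ _ _ _ germ_immediate). Qed.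

End GermField.

(** * Kaplansky's construction of a proper immediate extension *)

Section StablePolynomials.
Implicit Types p q : {poly K}.

Definition poly_stable p := stable (horner p).

Lemma near_all (A : K -> Prop) : (forall y, A y) -> near A.
Proof. by move=> hA; apply: near_sub near_true _ => y _. Qed.

Lemma poly_stable_ext (f : K -> K) p :
  (forall y, f y = p.[y]) -> stable f -> poly_stable p.
Proof. by move=> e; apply: (stable_ext); exact: near_all. Qed.

Lemma poly_stableC (c : K) : c != 0 -> poly_stable c%:P.
Proof.
by move=> c0; apply: poly_stable_ext (stable_cst c0) => y; rewrite hornerC.
Qed.

Lemma poly_stableM p q : poly_stable p -> poly_stable q -> poly_stable (p * q).
Proof.
move=> sp sq; apply: poly_stable_ext (stable_mul sp sq) => y.
by rewrite hornerM.
Qed.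

Lemma poly_stable_cancell p q : poly_stable p -> poly_stable (p * q) -> poly_stable q.
Proof.
move=> sp spq; apply: (stable_cancell sp).
by apply: (stable_ext) spq; apply: near_all => y; rewrite hornerM.
Qed.

Section Transcendental.
Hypothesis all_stable : forall p, p != 0 -> poly_stable p.

Definition frac_eval (z : {fraction {poly K}}) (y : K) : K :=
  (\n_(repr z)).[y] / (\d_(repr z)).[y].

Lemma numden_frac (z : {fraction {poly K}}) :
  z * FracField.tofrac \d_(repr z) = FracField.tofrac \n_(repr z).
Proof.
set x := repr z; have -> : z = \pi_({fraction {poly K}})%qT x by rewrite reprK.
have dx : \d_x != 0 by exact: denom_ratioP.
unlock FracField.tofrac; rewrite -[LHS]FracField.pi_mul; apply/eqmodP.
by rewrite /= FracField.equivfE !numden_Ratio ?mulf_neq0 ?oner_neq0 // !mulr1 mulrC.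
Qed.

Lemma frac_numer_neq0 (z : {fraction {poly K}}) : z != 0 -> \n_(repr z) != 0.
Proof.
apply: contraNneq => n0; have := numden_frac z; rewrite n0 rmorph0 => /eqP.
by rewrite mulf_eq0 tofrac_eq0 (negPf (denom_ratioP _)) orbF.
Qed.

(** [frac_eval] uses an arbitrary representative of the fraction. Another one gives the same value
    wherever both denominators are nonzero, which is eventually the case by stability. *)
Lemma frac_evalP (z : {fraction {poly K}}) p q : q != 0 ->
  z * FracField.tofrac q = FracField.tofrac p ->
  near (fun y => q.[y] <> 0 /\ frac_eval z y = p.[y] / q.[y]).
Proof.
move=> q0 zqp; have d0 : \d_(repr z) != 0 by exact: denom_ratioP.
apply: near_sub (near_and (stable_neq0 (all_stable q0))
                          (stable_neq0 (all_stable d0))) _.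
move=> y [/eqP hq /eqP hd]; split; first exact/eqP.
apply/eqP; rewrite eqr_div // -!hornerM; apply/eqP; congr (_.[y]).
apply/eqP; rewrite -tofrac_eq !rmorphM /= -zqp -numden_frac; apply/eqP.
by rewrite mulrAC.
Qed.

(** Nonzero rational functions are quotients of stable polynomials, so their germs turn the rational
    function field into an immediate extension; it is proper, as ['X] is not a constant. *)
Lemma not_maximal_transcendental : ~ maximal v.
Proof.
move=> mv.
pose phi : {rmorphism K -> {fraction {poly K}}} := @FracField.tofrac _ \o polyC.
suff [x /= /eqP] : exists x, phi x = FracField.tofrac 'X.
  rewrite tofrac_eq => /eqP/(congr1 (fun p : {poly K} => size p)).
  by rewrite size_polyX size_polyC; case: (_ == _).
apply: (germ_onto (ev := frac_eval)) mv _.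
- move=> z z0.
  have d0 : \d_(repr z) != 0 by exact: denom_ratioP.
  have n0 : \n_(repr z) != 0.
    exact: (frac_numer_neq0 z0).
  exact: stable_mul (all_stable n0)
            (stable_inv (all_stable d0)).
- move=> x; apply: near_sub (@frac_evalP (phi x) x%:P 1 (oner_neq0 _) _) _.
    by rewrite rmorph1 mulr1.
  by move=> y [_ ->]; rewrite !hornerE divr1.
- move=> z t; have dz : \d_(repr z) != 0 by exact: denom_ratioP.
  have dt : \d_(repr t) != 0 by exact: denom_ratioP.
  have [nz nt] := (numden_frac z, numden_frac t).
  apply: near_sub (near_and (frac_evalP dz nz) (near_and (frac_evalP dt nt)
    (@frac_evalP (z + t) (\n_(repr z) * \d_(repr t) + \n_(repr t) * \d_(repr z))
       (\d_(repr z) * \d_(repr t)) _ _))) _.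
  + by rewrite mulf_neq0.
  + by rewrite rmorphD !rmorphM /= -nz -nt mulrDl !mulrA [t * _ * _]mulrAC.
  move=> y [[/eqP hz ->] [[/eqP ht ->] [_ ->]]].
  by rewrite !hornerE addf_div.
move=> z t z0 t0; have dz : \d_(repr z) != 0 by exact: denom_ratioP.
have dt : \d_(repr t) != 0 by exact: denom_ratioP.
have [nz nt] := (numden_frac z, numden_frac t).
have n0 : \n_(repr z) * \n_(repr t) != 0.
  by rewrite mulf_neq0 ?(frac_numer_neq0 z0) ?(frac_numer_neq0 t0).
have dzt : \d_(repr z) * \d_(repr t) != 0 by apply: mulf_neq0.
have nzt : z * t * FracField.tofrac (\d_(repr z) * \d_(repr t)) =
    FracField.tofrac (\n_(repr z) * \n_(repr t)).
  by rewrite !rmorphM /= -nz -nt mulrACA.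
have near_n := stable_neq0 (all_stable n0).
apply: near_sub (near_and (near_and (frac_evalP dz nz) (frac_evalP dt nt))
  (near_and near_n (frac_evalP dzt nzt))) _.
move=> y [[[/eqP hz ->] [/eqP ht ->]] [/eqP hn [_ ->]]].
rewrite !hornerM mulf_div subrr val0.
have [|g ->] := @val_neq0 _ _ v ((\n_(repr z)).[y] * (\n_(repr t)).[y] /
  ((\d_(repr z)).[y] * (\d_(repr t)).[y])); last by [].
by rewrite mulf_neq0 -?hornerM // invr_eq0 hornerM mulf_neq0.
Qed.

End Transcendental.

Section Algebraic.
Variable p : {poly K}.
Hypothesis p_unstable : ~ poly_stable p.
Hypothesis p_monic : p \is monic.
Hypothesis small_stable : forall q, q != 0 -> (size q < size p)%N -> poly_stable q.

(** In a proper factorization both factors would be smaller than [p], hence stable, and so would be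
    their product. *)
Lemma unstable_irreducible : (1 < size p)%N -> irreducible_poly p.
Proof.
move=> p1; split=> // q q1 /dvdpP [r er].
have p0 : p != 0 by exact: monic_neq0.
have [r0 q0] : r != 0 /\ q != 0 by apply/andP; rewrite -negb_or -mulf_eq0 -er.
have qp : q %| p by apply/dvdpP; exists r.
rewrite -dvdp_size_eqp //.
have := dvdp_leq p0 qp; rewrite leq_eqVlt => /orP[//|ltq].
have rp : r %| p by apply/dvdpP; exists q; rewrite mulrC.
have ltr : (size r < size p)%N.
  rewrite er size_mul //.
  have : (0 < size q)%N by rewrite size_poly_gt0.
  by case: (size q) q1 => [|[|n]] // _ _; rewrite addnS /= addnS ltnS leq_addr.
by case: p_unstable; rewrite er; apply: poly_stableM; apply: small_stable.
Qed.

(* If [z t = q p + r] is the division by the minimal unstable [p], then the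
   leading terms of [z t] and [r] agree: otherwise [z t - r = q p] would be
   stable, and so would be [p]. *)
Lemma not_maximal_algebraic : (2 < size p)%N -> ~ maximal v.
Proof.
move=> p2 mv.
have pI : monic_irreducible_poly p by split=> //; apply: unstable_irreducible; exact: ltnW.
pose F : fieldType := {poly %/ p with pI}.
pose phi : {rmorphism K -> F} := qpolyC p.
pose ev (z : F) (y : K) := (z : {poly K}).[y].
have size_F (z : F) : (size (z : {poly K}) < size p)%N.
  by apply: leq_trans (size_mk_monic z) _; rewrite (mk_monicE pI).
have F_neq0 (z : F) : z != 0 -> (z : {poly K}) != 0 by [].
(* By [p2], ['X] is its own remainder modulo [p], hence not a constant. *)
suff [x /(congr1 (fun z : F => size (z : {poly K})))] : exists x, phi x = in_qpoly p 'X.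
  by rewrite qpolyXE // size_polyX /= size_polyC; case: (_ == _).
apply: (germ_onto (ev := ev)) mv _.
- by move=> z /F_neq0 z0; apply: small_stable.
- by move=> x; apply: near_all => y; rewrite /ev /= hornerC.
- by move=> z t; apply: near_all => y; rewrite /ev /= hornerD.
move=> z t /F_neq0 z0 /F_neq0 t0.
have sz := small_stable z0 (size_F z); have st := small_stable t0 (size_F t).
have sm := poly_stableM sz st.
have nzt : z * t != 0 :> F by apply: mulf_neq0.
have sr := small_stable (F_neq0 _ nzt) (size_F (z * t)).
have [hn|hs] := stable_sub sm sr.
  by apply: near_sub hn _ => y; rewrite hornerM.
case: p_unstable.
pose q := ((z : {poly K}) * (t : {poly K})) %/ p.
have eq : (z : {poly K}) * (t : {poly K}) = q * p + (z * t : F).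
  rewrite {1}(divp_eq (_ * _) p); congr (_ + _).
  have -> : ((z * t : F) : {poly K}) = Pdiv.Ring.rmodp ((z : {poly K}) * t) (mk_monic p).
    by exact: poly_of_qpolyM.
  move: (polyn z) (polyn t) => f g.
  by rewrite (mk_monicE pI) Pdiv.IdomainMonic.modpE.
have sqp : poly_stable (q * p).
  apply: poly_stable_ext hs => y.
  by rewrite -hornerN -hornerD eq addrK.
apply: (poly_stable_cancell _ sqp); apply: small_stable.
  apply/eqP => q0; have [y hy] := near_ex (stable_neq0 sqp).
  by apply: hy; rewrite q0 mul0r horner0.
rewrite size_divp ?monic_neq0 //.
move: (size_polyMleq (z : {poly K}) (t : {poly K})) (size_F z) (size_F t) p2.
move: (size (polyn z * polyn t)) (size (polyn z)) (size (polyn t)) (size p).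
by move=> a b c d; lia.
Qed.

End Algebraic.

Hypothesis X_stable : forall x, stable (fun y => y - x).

(** Either all nonzero polynomials are stable, or an unstable one of least size, made monic, yields
    an algebraic immediate extension. Its degree is at least 2: constants are stable, and
    [X_stable], by which no [x] in [K] is a limit of the filter, handles linear polynomials. *)
Lemma filter_not_maximal : ~ maximal v.
Proof.
move=> mv.
have [all_st|] := pselect (forall p, p != 0 -> poly_stable p).
  exact: not_maximal_transcendental.
move=> nall.
have ex : exists n, `[< exists p, [/\ p != 0, ~ poly_stable p & size p = n] >].
  apply: contra_notP nall => h p p0; apply: contra_notP h => sp.
  by exists (size p); apply/asboolP; exists p.
case: (ex_minnP ex) => n /asboolP[p [p0 sp szp]] minn.
have lp : lead_coef p != 0 by rewrite lead_coef_eq0.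
have lpV : (lead_coef p)^-1 != 0 by rewrite invr_eq0.
pose p' := (lead_coef p)^-1 *: p.
have szp' : size p' = n by rewrite size_scale.
have sp' : ~ poly_stable p'.
  move=> sp'; apply: sp.
  have -> : p = (lead_coef p)%:P * p' by rewrite mul_polyC scalerA divff // scale1r.
  by apply: poly_stableM sp'; exact: poly_stableC.
have small q : q != 0 -> (size q < size p')%N -> poly_stable q.
  rewrite szp' => q0 ltq; apply: contrapT => sq.
  have := minn (size q); rewrite leqNgt ltq => h; suff : false by [].
  by apply: h; apply/asboolP; exists q.
have p'm : p' \is monic by rewrite monicE lead_coefZ mulVf.
apply: (not_maximal_algebraic sp' p'm small) mv.
rewrite ltnNge; apply/negP; rewrite leq_eqVlt ltnS => /orP[/eqP sz2|]; last first.
  move=> /size1_polyC e; apply: sp'; move: p'm; rewrite e => /monic_neq0.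
  by rewrite polyC_eq0; exact: poly_stableC.
apply: sp'; apply: poly_stable_ext (X_stable (- p'`_0)) => y.
rewrite opprK horner_coef sz2 !big_ord_recl big_ord0 /= expr0 mulr1 expr1 addr0.
by move/monicP: p'm; rewrite lead_coefE sz2 /= => ->; rewrite mul1r addrC.
Qed.

End StablePolynomials.

End Germs.

(** * Spherical completeness of maximal fields *)

(* A ball is given by its center and the final segment of its radii. Final
   segments rather than values are used because a ball of an extension of [K]
   need not cut out of [K] a ball whose radius is a value of [K]. *)
Definition upclosed (G : oagType) (U : option G -> Prop) :=
  forall g h, U g -> vle g h -> U h.

(** The pairwise condition says that of any two balls one contains the center of the other, so that
    they are nested; for [i = j] it says that [U i] contains oo, so that no ball is empty. *)
Definition spherically_complete (K : fieldType) (G : oagType) (v : valuation K G)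
    (V : K -> Prop) : Prop :=
  forall (I : Type) (a : I -> K) (U : I -> option G -> Prop),
    (forall i, V (a i)) -> (forall i, upclosed (U i)) ->
    (forall i j, U i (v (a i - a j)) \/ U j (v (a i - a j))) ->
  exists2 x, V x & forall i, U i (v (x - a i)).

Lemma upclosed_add (K : fieldType) (G : oagType) (v : valuation K G) U x y :
  upclosed U -> U (v x) -> U (v y) -> U (v (x + y)).
Proof.
by move=> upU Ux Uy; apply: upU (val_add v x y); rewrite /vmin; case: ifP.
Qed.

Lemma upclosed_sub (K : fieldType) (G : oagType) (v : valuation K G) U x y :
  upclosed U -> U (v x) -> U (v y) -> U (v (x - y)).
Proof. by move=> upU Ux Uy; apply: upclosed_add; rewrite ?valN. Qed.

Lemma upclosed_total (G : oagType) (U V : option G -> Prop) :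
  upclosed U -> upclosed V -> (forall g, U g -> V g) \/ (forall g, V g -> U g).
Proof.
move=> upU upV; have [|nUV] := pselect (forall g, U g -> V g); [by left|right].
move=> g Vg; apply: contra_notP nUV => nUg h Uh.
have [gh|hg] := orP (vle_total g h); first exact: upV gh.
by case: nUg; exact: upU hg.
Qed.

(** The balls generate a filter. Without a common point, any [x] misses some ball, and [y - x] is
    stable on it: points [y], [z] of the ball with [v (y - z) <= v (y - x)] would put [x] into
    it. *)
Lemma maximal_spherically_complete (K : fieldType) (G : oagType) (v : valuation K G) :
  maximal v -> spherically_complete v (fun=> True).
Proof.
move=> mv I a U _ upU pairU; apply: contrapT => nolim.
have {}nolim x : exists i, ~ U i (v (x - a i)).
  apply: contrapT => h; apply: nolim; exists x => // i.
  by apply: contrapT => h'; apply: h; exists i.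
pose near (A : K -> Prop) := exists i, forall y, U i (v (y - a i)) -> A y.
apply: (@filter_not_maximal K G v near) mv.
- by move=> A B [i hi] AB; exists i => y /hi /AB.
- move=> A B [i hi] [j hj].
  wlog Uij : A B i j hi hj / forall g, U i g -> U j g.
    move=> W; case: (upclosed_total (upU i) (upU j)) => h; first exact: W hi hj h.
    by have [k hk] := W _ _ _ _ hj hi h; exists k => y /hk[].
  exists i => y Uy; split; first exact: hi.
  apply: hj; have -> : y - a j = y - a i + (a i - a j) by rewrite subrKA.
  apply: upclosed_add; [exact: upU | exact: Uij |].
  by case: (pairU i j) => // /Uij.
- by have [i _] := nolim 0; exists i.
- by move=> A [i hi]; exists (a i); apply: hi; case: (pairU i i).
move=> x; have [i ni] := nolim x; exists (fun y => U i (v (y - a i))).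
  by exists i.
move=> y z Uy Uz; rewrite opprB subrKA; apply/negP => le; apply: ni.
have -> : x - a i = (y - a i) - (y - x) by rewrite opprB [RHS]addrC subrKA.
apply: (upclosed_sub (upU i) Uy); apply: (upU i _ _ _ le).
have -> : y - z = (y - a i) - (z - a i) by rewrite opprB subrKA.
exact: upclosed_sub (upU i) Uy Uz.
Qed.

Lemma spherically_complete_image (K L : fieldType) (G H : oagType)
    (v : valuation K G) (w : valuation L H) (E : valued_extension v w) (V : K -> Prop) :
  spherically_complete v V ->
  spherically_complete w (fun x => exists2 t, V t & ext_field E t = x).
Proof.
move=> scV I a U Va upU pairU.
have [|b hb] := @choice I K (fun i t => V t /\ ext_field E t = a i).
  by move=> i; have [t Vt <-] := Va i; exists t.
have val_ab i x : w (ext_field E x - a i) = omap (ext_group E) (v (x - b i)).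
  by have [_ <-] := hb i; rewrite -rmorphB ext_val.
have [i|i g h|i j|x Vx hx] := scV I b (fun i g => U i (omap (ext_group E) g)).
- by have [] := hb i.
- move=> Ug gh; apply: upU Ug _; case: g h gh => [g|] [h|] //=.
  by rewrite ext_group_mono.
- by rewrite -val_ab; have [_ ->] := hb i.
by exists (ext_field E x); [exists x | move=> i; rewrite val_ab].
Qed.

(** * Finite-dimensional subspaces over a spherically complete field *)

Section Subspaces.
Variables (K M : fieldType) (H : oagType) (w : valuation M H) (e : {rmorphism K -> M}).
Implicit Types (V : M -> Prop) (x y : M) (c : K).

(** The balls around each [b] in [V] of radius [w (y - b)] all contain [y], hence are nested; a
    common point in [V] is at least as close to [y] as every [b]. *)
Lemma best_approximation V y : spherically_complete w V -> V 0 ->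
  exists2 a, V a & forall b, V b -> vle (w (y - b)) (w (y - a)).
Proof.
move=> scV V0.
have [|b g h|b c|a Va ha] := scV {b | V b} sval (fun b => vle (w (y - sval b))).
- by case.
- exact: vle_trans.
- have -> : sval b - sval c = (y - sval c) - (y - sval b).
    by rewrite opprB [RHS]addrC subrKA.
  have [le|le] := orP (vle_total (w (y - sval b)) (w (y - sval c))); [left|right].
    exact: val_subge (vle_refl _).
  exact: val_subge (vle_refl _) _.
exists a => // b Vb; have -> : y - a = (y - b) - (a - b) by rewrite opprB subrKA.
by apply: val_subge (vle_refl _) _; exact: (ha (exist _ b Vb)).
Qed.

Definition subspace V :=
  [/\ V 0, forall x y, V x -> V y -> V (x + y) & forall c x, V x -> V (e c * x)].

Definition adjoin V y x := exists2 a, V a & exists c, x = a + e c * y.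

Lemma subspace_adjoin V y : subspace V -> subspace (adjoin V y).
Proof.
case=> V0 VD VZ; split.
- by exists 0 => //; exists 0; rewrite rmorph0 mul0r addr0.
- move=> _ _ [a Va [c ->]] [b Vb [d ->]]; exists (a + b); first exact: VD.
  by exists (c + d); rewrite rmorphD mulrDl addrACA.
move=> d _ [a Va [c ->]]; exists (e d * a); first exact: VZ.
by exists (d * c); rewrite rmorphM mulrDr mulrA.
Qed.

Lemma adjoin_sub V y a : subspace V -> V a -> adjoin V (y - a) = adjoin V y.
Proof.
move=> [V0 VD VZ] Va; apply: funext => x; apply/propext; split=> -[b Vb [c ->]].
  exists (b + e (- c) * a); first by apply: VD => //; exact: VZ.
  by exists c; rewrite rmorphN mulrBr mulNr addrA addrAC.
exists (b + e c * a); first by apply: VD => //; exact: VZ.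
by exists c; rewrite mulrBr [e c * y - _]addrC addrA addrK.
Qed.

Lemma adjoin_mem V y : subspace V -> V y -> adjoin V y = V.
Proof.
move=> [V0 VD VZ] Vy; apply: funext => x; apply/propext; split=> [[a Va [c ->]]|Vx].
  by apply: VD => //; exact: VZ.
by exists x => //; exists 0; rewrite rmorph0 mul0r addr0.
Qed.

(* [y] is orthogonal to [V] once [0] is a best approximation of [y] in [V]. *)
Lemma orthogonal_le V y a c : subspace V -> V a ->
  (forall b, V b -> vle (w (y - b)) (w y)) ->
  vle (w (a + e c * y)) (w (e c * y)).
Proof.
move=> [V0 VD VZ] Va orth; have [->|c0] := eqVneq c 0.
  by rewrite rmorph0 mul0r addr0 val0; case: (w a).
have ec0 : e c != 0 by rewrite fmorph_eq0.
have -> : a + e c * y = e c * (y - e (- c^-1) * a).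
  by rewrite rmorphN fmorphV mulNr opprK mulrDr mulVKf // addrC.
rewrite !val_mul; apply: vle_add (vle_refl _) _; apply: orth; exact: VZ.
Qed.

Hypothesis scK : spherically_complete w (fun x => exists t, e t = x).

(** Subtracting a best approximation makes [y] orthogonal to [V]. Both components of [a + e c * y]
    then have at least the value of the sum, so nested balls project to nested balls in [V] and in
    the line of [y], and common points of the projections add up to one. *)
Lemma spherically_complete_adjoin V y :
  spherically_complete w V -> subspace V -> spherically_complete w (adjoin V y).
Proof.
move=> scV sV; have [V0 VD VZ] := sV.
have VB b b' : V b -> V b' -> V (b - b').
  by move=> Vb Vb'; apply: VD => //; rewrite -mulN1r -(rmorph1 e) -rmorphN; exact: VZ.
have [a Va ha] := best_approximation y scV V0.
rewrite -(adjoin_sub y sV Va).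
have {}ha b : V b -> vle (w (y - a - b)) (w (y - a)).
  by move=> Vb; rewrite -addrA -opprD; apply: ha; exact: VD.
move: (y - a) ha => {Va}y {a}orth.
have [y0|y0] := eqVneq y 0; first by rewrite y0 adjoin_mem.
have [g wy] := val_neq0 w y0.
move=> I x U Ax upU pairU.
have [|ab hab] := @choice I (M * K) (fun i t => V t.1 /\ x i = t.1 + e t.2 * y).
  by move=> i; have [a Va [c ->]] := Ax i; exists (a, c).
pose a i := (ab i).1; pose c i := (ab i).2.
have Va i : V (a i) by have [] := hab i.
have xE i : x i = a i + e (c i) * y by have [] := hab i.
have xB i j : x i - x j = (a i - a j) + e (c i - c j) * y.
  by rewrite !xE rmorphB mulrBl opprD addrACA.
have leC i j : vle (w (x i - x j)) (w (e (c i - c j) * y)).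
  by rewrite xB; apply: (orthogonal_le (V := V)) => //; exact: VB.
have leA i j : vle (w (x i - x j)) (w (a i - a j)).
  have -> : a i - a j = (x i - x j) - e (c i - c j) * y by rewrite xB addrK.
  exact: val_subge (vle_refl _) _.
have [i j|a0 Va0 ha0] := scV I a U Va upU.
  by case: (pairU i j) => h; [left|right]; apply: upU (leA i j).
(* A coefficient [c] contributes [w (e c)] plus the value [g] of [y], so the radii for coefficients
   are shifted by [g]. *)
have [i|i h k|i j|_ [c0 <-] hc0] :=
  scK (a := fun i => e (c i)) (U := fun i h => U i (vadd h (Some g))).
- by exists (c i).
- by move=> Uh hk; apply: upU Uh _; exact: vle_add2r.
- rewrite -wy -val_mul -rmorphB.
  by case: (pairU i j) => h; [left|right]; apply: upU (leC i j).
exists (a0 + e c0 * y); first by exists a0 => //; exists c0.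
move=> i; rewrite xE opprD addrACA -mulrBl; apply: upclosed_add => //.
by rewrite val_mul wy.
Qed.

Definition lin_span (b : nat -> M) n x := exists c : nat -> K, x = \sum_(i < n) e (c i) * b i.

Lemma lin_span0 b : lin_span b 0 = eq^~ 0.
Proof.
apply: funext => x; apply/propext; split=> [[c ->]|->]; first by rewrite big_ord0.
by exists (fun=> 0); rewrite big_ord0.
Qed.

Lemma lin_spanS b n : lin_span b n.+1 = adjoin (lin_span b n) (b n).
Proof.
apply: funext => x; apply/propext; split=> [[c ->]|[_ [c ->] [d ->]]].
  rewrite big_ord_recr /=; exists (\sum_(i < n) e (c i) * b i); first by exists c.
  by exists (c n).
exists (fun i => if i == n then d else c i); rewrite big_ord_recr /= eqxx.
by congr (_ + _); apply: eq_bigr => i _; rewrite ltn_eqF.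
Qed.

Lemma subspace_lin_span b n : subspace (lin_span b n).
Proof.
elim: n => [|n IH]; last by rewrite lin_spanS; exact: subspace_adjoin.
rewrite lin_span0; split=> // [_ _ -> ->|c _ ->]; [exact: addr0 | exact: mulr0].
Qed.

Lemma spherically_complete_lin_span b n : spherically_complete w (lin_span b n).
Proof.
elim: n => [|n IH]; last first.
  by rewrite lin_spanS; apply: spherically_complete_adjoin => //; exact: subspace_lin_span.
rewrite lin_span0 => I a U a0 upU pairU; exists 0 => // i.
by case: (pairU i i); rewrite (a0 i) subrr.
Qed.

(** Let [a] be a best approximation of [b n] by the previous vectors. Orthogonality of [b n - a],
    nonzero by freeness, bounds the last coordinate; the others follow by induction after removing
    the last term. *)
Lemma free_coord_bound (b : nat -> M) n :
  (forall i, (i < n)%N -> ~ lin_span b i (b i)) ->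
  exists g : H, forall (c : nat -> K) i, (i < n)%N ->
    vle (w (\sum_(i < n) e (c i) * b i)) (vadd (w (e (c i))) (Some g)).
Proof.
elim: n => [|n IH] free; first by exists 0.
have [g hg] := IH (fun i h => free i (ltnW h)).
have sV := subspace_lin_span b n; have [V0 VD VZ] := sV.
have [a Va ha] := best_approximation (b n) (@spherically_complete_lin_span b n) V0.
have ba0 : b n - a != 0.
  by rewrite subr_eq0; apply/eqP => ba; apply: (free n (ltnSn n)); rewrite ba.
have [g1 wg1] := val_neq0 w ba0.
have b0 : b n != 0 by apply/eqP => b0; apply: (free n (ltnSn n)); rewrite b0.
have [h wh] := val_neq0 w b0.
have le_n s c : lin_span b n s -> vle (w (s + e c * b n)) (vadd (w (e c)) (Some g1)).
  move=> Vs; have -> : s + e c * b n = (s + e c * a) + e c * (b n - a).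
    by rewrite mulrBr addrA addrAC addrK.
  rewrite -wg1 -val_mul; apply: (orthogonal_le (V := lin_span b n)) => //.
    by apply: VD => //; exact: VZ.
  by move=> x Vx; rewrite wg1 -wg1 -addrA -opprD; apply: ha; exact: VD.
have vmaxP (p q : H) : exists r, p <= r /\ q <= r.
  by case/orP: (oag_total p q) => pq; [exists q | exists p].
(* [g1] serves the last coordinate. For the others, removing the last term costs at most [g1 - h],
   with [h] and [g1] the values of [b n] and [b n - a]. *)
have [r [r1 r2]] := vmaxP g1 (g + (g1 - h)).
exists r => c i; rewrite big_ord_recr /= ltnS.
set s := \sum_(i < n) _; have Vs : lin_span b n s by exists c.
have le_r (k : H) : k <= r -> forall m, vle (vadd m (Some k)) (vadd m (Some r)).
  by move=> kr m; apply: vle_add (vle_refl _) _.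
rewrite leq_eqVlt => /orP[/eqP->|lt_in].
  by apply: vle_trans (le_n _ _ Vs) (le_r _ r1 _).
apply: vle_trans (le_r _ r2 _).
have -> : vadd (w (e (c i))) (Some (g + (g1 - h))) =
   vadd (vadd (w (e (c i))) (Some g)) (Some (g1 - h)) by rewrite -vaddA.
apply: vle_trans (vle_add2r _ (hg c i lt_in)).
rewrite -(vle_add2rE (h - g1)) -vaddA /= addrA subrK subrr.
have -> : vadd (w s) (Some 0) = w s by case: (w s) => //= x; rewrite addr0.
(* [0] competes with the best approximation [a]. *)
have hle : h <= g1.
  by have := ha 0 V0; rewrite subr0 wh wg1.
have {2}-> : s = (s + e (c n) * b n) - e (c n) * b n by rewrite addrK.
apply: val_subge.
  case: (w _) => //= x; rewrite -[leRHS]addr0; apply: oag_lerD2l.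
  by have := oag_lerD2l (- g1) _ _ hle; rewrite addNr addrC.
rewrite val_mul wh -(vle_add2rE (g1 - h)) -!vaddA /= addrA subrK subrr addrCA subrr addr0.
by have := le_n s (c n) Vs; case: (w _) => //= x; rewrite addr0.
Qed.

End Subspaces.

(** * Immediate extensions and the finite case *)

(** Write [x = q * d] with [d] from [L] of the same value as [x]. Replacing the unit [q] by an
    element of [L] with the same residue changes the product only by a term of higher value. *)
Lemma immediate_approximation (L M : fieldType) (G H : oagType)
    (w : valuation L G) (u : valuation M H) (E : valued_extension w u) (x : M) :
  immediate E -> x != 0 -> exists t, vlt (u x) (u (x - ext_field E t)).
Proof.
move=> [immG immR] x0; have [h ux] := val_neq0 u x0.
have [g gh] := immG h; have [d wd] := val_onto w g.
have ud : u (ext_field E d) = Some h by rewrite ext_val wd /= gh.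
have d0 : ext_field E d != 0 by apply/eqP => d0; rewrite d0 val0 in ud.
have [q xq] : exists q, x = q * ext_field E d.
  by exists (x / ext_field E d); rewrite divfK.
have uq : u q = Some 0.
  have := ux; rewrite xq val_mul ud; case: (u q) => //= k [/eqP].
  by rewrite -subr_eq0 addrK => /eqP->.
have qO : q \in valring_pred u by rewrite inE uq vle_refl.
have [r] := immR (residue_pi (ValRing qO)).
rewrite -(residue_reprK r) ext_residueE => /esym/eqP.
rewrite residue_piE inE rmorphB /= => lt0.
exists (valring_val (residue_repr r) * d).
rewrite rmorphM xq -mulrBl !val_mul ud vlt_add2r uq.
exact: lt0.
Qed.

Lemma immediate_onto (L M : fieldType) (G H : oagType)
    (w : valuation L G) (u : valuation M H) (E : valued_extension w u) :
  immediate E -> spherically_complete u (fun x => exists t, ext_field E t = x) ->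
  forall y, exists x, ext_field E x = y.
Proof.
move=> imm scL y.
have [|a [t ta] ha] := best_approximation y scL; first by exists 0; rewrite rmorph0.
have [/eqP|ya0] := eqVneq (y - a) 0.
  by rewrite subr_eq0 => /eqP ->; exists t.
have [s lt_s] := immediate_approximation imm ya0.
have := ha (a + ext_field E s); rewrite opprD addrA vleNgt lt_s => h.
suff : false by [].
by apply: h; exists (t + s); rewrite rmorphD ta.
Qed.

Lemma maximal_image (K L : fieldType) (G H : oagType)
    (v : valuation K G) (w : valuation L H) (E : valued_extension v w) :
  maximal v -> spherically_complete w (fun x => exists t, ext_field E t = x).
Proof.
move=> mv; have := spherically_complete_image (E := E) (maximal_spherically_complete mv).
congr spherically_complete; apply: funext => x; apply/propext.
by split=> [[t _ <-]|[t <-]]; exists t.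
Qed.

Lemma finite_extension_maximal (K L : fieldType) (G H : oagType)
    (v : valuation K G) (w : valuation L H) (E : valued_extension v w) :
  maximal v -> finite_extension (ext_field E) -> maximal w.
Proof.
move=> mv [n [b hb]] M F u E' imm.
pose e : {rmorphism K -> M} := ext_field E' \o ext_field E.
(* The basis of [L], mapped to [M] and padded with zeros; its span over [K] is the image of [L]. *)
pose b' i := if insub i is Some k then ext_field E' (b k) else 0.
have scK : spherically_complete u (fun x => exists t, e t = x).
  have := spherically_complete_image (E := E') (maximal_image (E := E) mv).
  congr spherically_complete; apply: funext => x; apply/propext.
  by split=> [[_ [t <-] <-]|[t <-]]; [exists t | exists (ext_field E t) => //; exists t].
apply: immediate_onto imm _.
have := @spherically_complete_lin_span _ _ _ u e scK b' n.
congr spherically_complete; apply: funext => x; apply/propext; split=> [[c ->]|[y <-]].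
  exists (\sum_(i < n) ext_field E (c i) * b i); rewrite rmorph_sum.
  by apply: eq_bigr => i _; rewrite rmorphM /b' valK.
have [c [-> _]] := hb y.
exists (fun i => if insub i is Some k then c 0 k else 0); rewrite rmorph_sum.
by apply: eq_bigr => i _; rewrite rmorphM /b' valK.
Qed.

(** * Degrees of elements and primitive elements *)

Section Degree.
Variables (K L : fieldType) (e : {rmorphism K -> L}).
Implicit Types (p q : {poly K}) (y z : L).

(** A size of at most [n.+1] is a degree of at most [n]. Elements transcendental over [K] qualify
    for every [n]. *)
Definition degree_gt n y := forall p, p != 0 -> (size p <= n.+1)%N -> ~~ root (map_poly e p) y.

Lemma degree_gt_free n y :
  degree_gt n y -> forall i, (i < n.+1)%N -> ~ lin_span e (fun i => y ^+ i) i (y ^+ i).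
Proof.
move=> dy i lt_in [c hc].
pose p := 'X^i - \poly_(j < i) c j.
have szp : size p = i.+1.
  by rewrite size_polyDl ?size_polyXn // size_polyN ltnS size_poly.
have p0 : p != 0 by rewrite -size_poly_eq0 szp.
have /negP := dy p p0 (eq_ind_r (fun k => (k <= n.+1)%N) lt_in szp); apply.
rewrite rootE rmorphB /= map_polyXn hornerD hornerN hornerXn hc.
rewrite poly_def rmorph_sum horner_sum subr_eq0; apply/eqP/eq_bigr => j _ /=.
by rewrite map_polyZ map_polyXn hornerZ hornerXn.
Qed.

(* Coordinates of the powers of [q] in the basis of powers of ['X] modulo [p]. *)
Definition power_coords p k q : 'M[K]_(k, (size p).-1) :=
  \matrix_(i < k) poly_rV ((q ^+ i) %% p).

Lemma mul_power_coords p k q (u : 'rV_k) :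
  u *m power_coords p k q = poly_rV ((rVpoly u \Po q) %% p).
Proof.
rewrite mulmx_sum_row.
have -> : rVpoly u = \sum_(i < k) u 0 i *: 'X^i.
  by rewrite /rVpoly poly_def; apply: eq_bigr => i _; rewrite valK.
rewrite [in RHS](raddf_sum (comp_poly q)) (big_morph _ (modpD p) (mod0p p)) raddf_sum.
apply: eq_bigr => i _; rewrite rowK /= comp_polyZ comp_Xn_poly modpZl.
by rewrite linearZ.
Qed.

Lemma root_poly_rV_modp p q z : p != 0 -> root (map_poly e p) z ->
  (map_poly e q).[z] = (map_poly e (rVpoly (poly_rV (q %% p) : 'rV_(size p).-1))).[z].
Proof.
move=> p0 pz; rewrite poly_rV_K; last first.
  by rewrite -ltnS prednK ?ltn_modp // size_poly_gt0.
rewrite {1}(divp_eq q p) rmorphD rmorphM hornerD hornerM /=.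
by move/rootP: pz => ->; rewrite mulr0 add0r.
Qed.

(** If [z] were a root of [p] of size at most [n.+1], the first [size p] powers of [q] modulo [p]
    would lie in dimension [(size p).-1]. A dependency among them is a polynomial of size at most
    [size p] vanishing at the value of [q] at [z]. *)
Lemma degree_gt_horner n q z : degree_gt n (map_poly e q).[z] -> degree_gt n z.
Proof.
move=> dy p p0 szp; apply/negP => pz.
have sp0 : (0 < size p)%N by rewrite size_poly_gt0.
pose A := power_coords p (size p) q.
have : kermx A != 0.
  rewrite -mxrank_eq0 mxrank_ker subn_eq0 -ltnNge.
  by apply: leq_ltn_trans (rank_leq_col _) _; rewrite prednK.
case/rowV0Pn => u /sub_kermxP uA u0.
have r0 : rVpoly u != 0 by apply: contraNneq u0 => r0; rewrite -[u]rVpolyK r0 raddf0.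
have /negP := dy _ r0 (leq_trans (size_poly _ _) szp); apply.
rewrite rootE -horner_comp -map_comp_poly.
by rewrite (root_poly_rV_modp _ p0 pz) -mul_power_coords uA !raddf0 horner0.
Qed.

(** Take [a] of largest degree [m.+1]. For any [y], a primitive element [z] for [a] and [y] has at
    least the degree of [a], hence the same. So the powers of [a] are a basis of the field generated
    by [z], which contains [y]. *)
Lemma finite_of_bounded_degree : [pchar K] =i pred0 -> algebraic_extension e ->
  (exists n, forall y, ~ degree_gt n y) -> finite_extension e.
Proof.
move=> char0 algL bounded.
have ex : exists n, `[< forall y, ~ degree_gt n y >].
  by have [n hn] := bounded; exists n; apply/asboolP.
case: (ex_minnP ex) => -[|m] /asboolP deg_le min.
  case: (deg_le 0) => p p0 sz1; have /size1_polyC e1 := sz1.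
  by move: p0; rewrite e1 polyC_eq0 map_polyC rootC fmorph_eq0.
have [a deg_a] : exists a, degree_gt m a.
  apply: contrapT => h; suff : false by [].
  have := min m; rewrite ltnn; apply; apply/asboolP => y dy.
  by apply: h; exists y.
have span_a y : exists u : 'rV_m.+1, y = (map_poly e (rVpoly u)).[a].
  have [p p0 pa] := algL a; have [q q0 qy] := algL y.
  have [n [[r ra] [s sy]]] := pchar0_PET p0 pa q0 qy char0.
  move: (y *+ n - a) ra sy => z ra sy.
  have deg_z : degree_gt m z by apply: (@degree_gt_horner _ r); rewrite ra.
  have [f [f0 szf fz]] : exists f : {poly K}, [/\ f != 0, size f = m.+2 & root (map_poly e f) z].
    apply: contrapT => h; apply: (deg_le z) => f f0 szf; apply/negP => fz; apply: h.
    exists f; split=> //; apply/eqP; rewrite eqn_leq szf /= ltnNge.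
    by apply/negP => szf'; have := deg_z f f0 szf'; rewrite fz.
  have predf : m.+1 = (size f).-1 by rewrite szf.
  pose A := power_coords f (size f).-1 r.
  (* A relation between the rows is a polynomial of degree at most [m] vanishing at [a]. *)
  have freeA : row_free A.
    rewrite -kermx_eq0; apply/eqP/row_matrixP => i; rewrite row0.
    move: (row i _) (row_sub i (kermx A)) => u /sub_kermxP uA.
    apply/eqP; apply: contraT => u0.
    have r0 : rVpoly u != 0 by apply: contraNneq u0 => r0; rewrite -[u]rVpolyK r0 raddf0.
    have szr : (size (rVpoly u) <= m.+1)%N.
      by apply: leq_trans (size_poly _ _) _; rewrite szf.
    have /negP := deg_a _ r0 szr; case.
    rewrite rootE -ra -horner_comp -map_comp_poly.
    by rewrite (root_poly_rV_modp _ f0 fz) -mul_power_coords uA !raddf0 horner0.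
  have uA : A \in unitmx by rewrite -row_free_unit.
  (* The coordinates of [y] on powers of [z], converted to powers of [a]. *)
  pose u := poly_rV (s %% f) *m invmx A.
  exists (castmx (erefl, esym predf) u).
  have -> : rVpoly (castmx (erefl, esym predf) u) = rVpoly u.
    by case: _ / (esym predf); rewrite castmx_id.
  rewrite -ra -horner_comp -map_comp_poly (root_poly_rV_modp _ f0 fz).
  by rewrite -mul_power_coords mulmxKV // -root_poly_rV_modp.
have rowE (u : 'rV_m.+1) :
    (map_poly e (rVpoly u)).[a] = \sum_(i < m.+1) e (u 0 i) * a ^+ i.
  rewrite (@horner_coef_wide _ m.+1); last by rewrite (leq_trans (size_poly _ _)) ?size_poly.
  by apply: eq_bigr => i _; rewrite coef_map coef_rVpoly_ord.
exists m.+1, (fun i => a ^+ i) => y.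
have [u yu] := span_a y; exists u; split; first by rewrite yu rowE.
move=> u'; rewrite -rowE yu => /eqP; rewrite -subr_eq0 -hornerN -hornerD -rmorphB -raddfB /=.
move=> uu'; apply/eqP; rewrite -subr_eq0; apply: contraT => nz.
have r0 : rVpoly (u - u') != 0 by apply: contraNneq nz => r0; rewrite -[_ - _]rVpolyK r0 raddf0.
by have := deg_a _ r0 (size_poly _ _); rewrite rootE uu'.
Qed.

End Degree.

(** * Openness of the set of elements of large degree *)

Lemma oag_max (G : oagType) (g h : G) : exists k, g <= k /\ h <= k.
Proof. by case/orP: (oag_total g h) => gh; [exists h | exists g]. Qed.

Lemma oag_min (G : oagType) (g h : G) : exists k, k <= g /\ k <= h.
Proof. by case/orP: (oag_total g h) => gh; [exists g | exists h]. Qed.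

Lemma val_lower_bound (L : fieldType) (H : oagType) (w : valuation L H) x :
  exists g : H, vle (Some g) (w x).
Proof. by case: (w x) => [g|]; [exists g; rewrite vle_refl | exists 0]. Qed.

Lemma val_mulrn_ge (L : fieldType) (H : oagType) (w : valuation L H) x n :
  vle (w x) (w (x *+ n)).
Proof.
elim: n => [|n IH]; first by rewrite mulr0n val0; case: (w x).
by rewrite mulrS; apply: val_addge IH; exact: vle_refl.
Qed.

Section Openness.
Variables (L : fieldType) (H : oagType) (w : valuation L H).
Implicit Types (g h : H) (x y z : L).

Lemma exp_lipschitz y i : exists g, forall z, vle (Some 0) (w (z - y)) ->
  vle (vadd (w (z - y)) (Some g)) (w (z ^+ i - y ^+ i)).
Proof.
elim: i => [|i [g hg]]; first by exists 0 => z _; rewrite subrr val0; case: (vadd _ _).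
have [m0 hm0] := val_lower_bound w y; have [k hk] := val_lower_bound w (y ^+ i).
(* [m] bounds [w z] from below on the ball around [y]; [r] is a common constant for the two terms of
   the decomposition below. *)
have [m [m_le_m0 m_le0]] := oag_min m0 0; have [r [r1 r2]] := oag_min (g + m) k.
exists r => z zy0.
have -> : z ^+ i.+1 - y ^+ i.+1 = (z ^+ i - y ^+ i) * z + (z - y) * y ^+ i.
  by rewrite !exprS mulrBl mulrBl addrA [z ^+ i * z]mulrC [_ * z]mulrC subrK.
have wz : vle (Some m) (w z).
  by rewrite -(subrK y z); apply: val_addge; [exact: vle_trans zy0 | exact: vle_trans hm0].
apply: val_addge; rewrite val_mul.
  apply: vle_trans (vle_add (hg z zy0) wz).
  by rewrite -vaddA; exact: vle_add (vle_refl _) _.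
by apply: vle_add (vle_refl _) _; exact: vle_trans hk.
Qed.

Lemma exp_lipschitz_unif y n : exists g, forall i z, (i < n)%N -> vle (Some 0) (w (z - y)) ->
  vle (vadd (w (z - y)) (Some g)) (w (z ^+ i - y ^+ i)).
Proof.
elim: n => [|n [g hg]]; first by exists 0.
have [h hh] := exp_lipschitz y n.
have [r [r1 r2]] := oag_min g h.
exists r => i z; rewrite ltnS leq_eqVlt => /orP[/eqP->|lt_in] zy0.
  by apply: vle_trans (hh z zy0); exact: vle_add (vle_refl _) _.
by apply: vle_trans (hg i z lt_in zy0); exact: vle_add (vle_refl _) _.
Qed.

Variables (K : fieldType) (e : {rmorphism K -> L}).
Hypothesis scK : spherically_complete w (fun x => exists t, e t = x).

(** If [p] of degree at most [n] vanishes at [z] near [y], then [p(y) = p(y) - p(z)] has value at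
    least [m + d + h], where [m] is the least value of a coefficient. But [free_coord_bound] makes
    it at most [m + g]. *)
Lemma degree_gt_open n y (t : H) : 0 < t -> degree_gt e n y ->
  exists g, forall z, vle (Some g) (w (z - y)) -> degree_gt e n z.
Proof.
move=> t0 dy; have [g hg] := free_coord_bound scK (degree_gt_free dy).
have [h hh] := exp_lipschitz_unif y n.+1.
(* [0 <= d] meets the condition of the Lipschitz bound, and [d + h >= g + t > g] gives the
   contradiction. *)
have [d [d0 dgh]] := oag_max 0 (g - h + t).
exists d => z zd p p0 szp; apply/negP => /rootP pz.
have zy0 : vle (Some 0) (w (z - y)) by apply: vle_trans zd.
have pE (x : L) : (map_poly e p).[x] = \sum_(i < n.+1) e p`_i * x ^+ i.
  rewrite (@horner_coef_wide _ n.+1) ?size_map_poly //.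
  by apply: eq_bigr => i _; rewrite coef_map.
have [k lt_k mink] : exists2 k, (k < n.+1)%N &
    forall i, (i < n.+1)%N -> vle (w (e p`_k)) (w (e p`_i)).
  elim: n.+1 (ltn0Sn n) => // -[|m] IH _; first by exists 0%N => // -[|i] // _; exact: vle_refl.
  have [k lt_k mink] := IH isT.
  have [le|le] := orP (vle_total (w (e p`_k)) (w (e p`_m.+1))).
    exists k; first exact: ltnW.
    by move=> i; rewrite ltnS leq_eqVlt => /orP[/eqP->//|]; exact: mink.
  exists m.+1 => // i; rewrite ltnS leq_eqVlt => /orP[/eqP->|]; first exact: vle_refl.
  by move/mink; exact: vle_trans.
have pk0 : e p`_k != 0.
  rewrite fmorph_eq0; apply/eqP => pk0; case/eqP: p0; apply/polyP => i; rewrite coef0.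
  have [lt_i|le_i] := ltnP i n.+1; last by rewrite nth_default // (leq_trans szp).
  have := mink i lt_i; rewrite pk0 rmorph0 val0.
  by case E: (w _) => // _; move/val_eq_oo/eqP: E; rewrite fmorph_eq0 => /eqP.
have [m wm] := val_neq0 w pk0.
have up := hg (fun i => p`_i) k lt_k; rewrite -pE wm in up.
have lo : vle (Some (m + (d + h))) (w (map_poly e p).[y]).
  have -> : (map_poly e p).[y] = - ((map_poly e p).[z] - (map_poly e p).[y]).
    by rewrite pz sub0r opprK.
  rewrite valN !pE -sumrB; apply: val_sum_ge => i _; rewrite -mulrBr val_mul.
  have -> : Some (m + (d + h)) = vadd (Some m) (Some (d + h)) by [].
  apply: vle_add; first by rewrite -wm; exact: mink.
  by apply: vle_trans (hh i z (ltn_ord i) zy0); exact: vle_add2r zd.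
have := vle_trans lo up; rewrite /= => le1.
have := oag_lerD2l (- m) _ _ le1; rewrite !addKr => le2.
have := oag_lerD2l h _ _ dgh; rewrite [h + d]addrC => le3.
have := le_trans le3 le2; rewrite addrA [h + _]addrC subrK => le4.
have := oag_lerD2l (- g) _ _ le4; rewrite addKr addNr => le5.
by have := lt_le_trans t0 le5; rewrite ltxx.
Qed.

End Openness.

(** * Density of large degrees and infinite extensions *)

Section InfiniteExtension.
Variables (K L : fieldType) (G H : oagType) (v : valuation K G) (w : valuation L H).
Variable E : valued_extension v w.
Hypothesis algE : algebraic_extension (ext_field E).
Local Notation e := (ext_field E).

(** If [w y = g > 0] exceeded all values of nonzero elements of [K], then, by inversion, these would
    all exceed the value of [t = y^-1]. In a monic equation for [t] over [K] the leading power would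
    have strictly least value. *)
Lemma algebraic_cofinal (g : H) : exists2 c : K, c != 0 & vle (Some g) (w (e c)).
Proof.
have [y wy] := val_onto w g; have y0 : y != 0 by apply/eqP => y0; rewrite y0 val0 in wy.
have [le|gt] := boolP (vle (w y) (Some 0)).
  by exists 1; rewrite ?oner_neq0 // rmorph1 Defs.val1 -wy.
apply: contrapT => h.
have {}h c : c != 0 -> vlt (w (e c)) (Some g).
  by move=> c0; apply/negP => le; apply: h; exists c.
pose t := y^-1; have yt : w (y * t) = Some 0 by rewrite divff // Defs.val1.
have [wt [wtE wtg]] : exists wt, w t = Some wt /\ g + wt = 0.
  by move: yt; rewrite val_mul wy; case: (w t) => //= wt [eq]; exists wt.
have wtN : g = - wt by apply/eqP; rewrite -addr_eq0 wtg.
have wt_lt0 : wt < 0.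
  have := gt; rewrite wy /= -oag_ltNge => g0; rewrite oag_ltNge; apply/negP => wt0.
  have := oag_lerD2l g _ _ wt0; rewrite wtg addr0 => g0'.
  by have := lt_le_trans g0 g0'; rewrite ltxx.
have wt_exp i n : (i <= n)%N -> vle (w (t ^+ n)) (w (t ^+ i)).
  elim: n => [|n IH]; first by rewrite leqn0 => /eqP->; exact: vle_refl.
  rewrite leq_eqVlt => /orP[/eqP->|]; first exact: vle_refl.
  rewrite ltnS => /IH; apply: vle_trans; rewrite exprSr val_mul wtE.
  by case: (w _) => //= x; rewrite -[leRHS]addr0; exact: oag_lerD2l (ltW wt_lt0).
have /integral_algebraic[p p_monic pt] := algE t.
have t0 : t != 0 by rewrite invr_eq0.
have [k wk] := val_neq0 w (expf_neq0 (size p).-1 t0).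
have wcoef (c : K) : vlt (Some wt) (w (e c)).
  have [->|c0] := eqVneq c 0; first by rewrite rmorph0 val0.
  have cV0 : c^-1 != 0 by rewrite invr_eq0.
  have [a wa] : exists a, w (e c) = Some a by apply: val_neq0; rewrite fmorph_eq0.
  have [b wb] : exists b, w (e c^-1) = Some b by apply: val_neq0; rewrite fmorph_eq0.
  have : w (e c * e c^-1) = Some 0 by rewrite -rmorphM divff // rmorph1 Defs.val1.
  rewrite val_mul wa wb => -[ab]; have := h _ cV0; rewrite wb.
  rewrite /vlt /= wtN; apply: contra => awt.
  have -> : b = - a by apply/eqP; rewrite -addr_eq0 addrC ab.
  have := oag_lerD2l (- a - wt) _ _ awt.
  by rewrite addrAC addNr add0r -addrA [- wt + wt]addrC subrr addr0.
have : vlt (w (t ^+ (size p).-1)) (w (\sum_(i < (size p).-1) e p`_i * t ^+ i)).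
  rewrite wk; have [->|] := eqVneq (\sum_(i < (size p).-1) e p`_i * t ^+ i) 0.
    by rewrite val0.
  move=> _; elim/big_ind: _ => [|x y'|i _]; [by rewrite val0 | exact: val_addgt |].
  (* The term of index [i] has value above that of [t ^+ i.+1], which is at least that of the
     leading power since [w t < 0]. *)
  rewrite -wk; apply: (vle_lt_trans (wt_exp i.+1 _ (ltn_ord i))).
  rewrite exprS !val_mul wtE.
  have [j wj] := val_neq0 w (expf_neq0 i t0).
  by rewrite wj vlt_add2r; exact: wcoef.
have szp : (size (map_poly e p) <= (size p).-1.+1)%N.
  by rewrite prednK ?size_map_poly // size_poly_gt0 monic_neq0.
move/rootP: pt; rewrite (horner_coef_wide _ szp) big_ord_recr /= coef_map.
move/monicP: p_monic; rewrite lead_coefE => ->; rewrite /= rmorph1 mul1r => /eqP.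
rewrite addr_eq0 => /eqP sumE.
under eq_bigr do rewrite -coef_map.
by rewrite sumE valN vlt_irrefl.
Qed.

Hypothesis char0 : [pchar K] =i pred0.

(** Scale [x] of large degree by [c] in [K] until [c x] is close to 0. A primitive element of the
    form [m c x + y] has [c x] as a polynomial expression, hence large degree, and differs from [y]
    only by [m c x]. *)
Lemma degree_gt_dense : (forall n, exists y, degree_gt e n y) ->
  forall n y (g : H), exists2 z, degree_gt e n z & vle (Some g) (w (z - y)).
Proof.
move=> unbounded n y g; have [x dx] := unbounded n.
have [k hk] := val_lower_bound w x; have [c c0 hc] := algebraic_cofinal (g - k).
have ec0 : e c != 0 by rewrite fmorph_eq0.
have [p p0 py] := algE (- y); have [q q0 qx] := algE (e c * x).
have [m [_ [s sx]]] := pchar0_PET p0 py q0 qx char0.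
exists (e c * x *+ m - - y).
  apply: (@degree_gt_horner _ _ _ _ (c^-1 *: s)).
  by rewrite map_polyZ hornerZ sx fmorphV mulKf.
rewrite opprK addrK; apply: vle_trans (val_mulrn_ge _ _ _).
by rewrite val_mul; have := vle_add hc hk; rewrite /= subrK.
Qed.

Lemma bounded_degree_of_maximal : nontrivial v -> maximal v -> maximal w ->
  exists n, forall y, ~ degree_gt e n y.
Proof.
move=> [x x0 vx0] mv mw; apply: contrapT => unb.
have {}unb n : exists y, degree_gt e n y.
  by apply: contrapT => h; apply: unb; exists n => y dy; apply: h; exists y.
have [t t0] : exists t : H, 0 < t.
  have ex0 : e x != 0 by rewrite fmorph_eq0.
  have [g wg] := val_neq0 w ex0.
  have g0 : g != 0.
    apply: contra vx0 => /eqP g0; have := ext_val E x; rewrite wg g0.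
    case: (v x) => //= k [/esym k0]; apply/eqP; congr Some; apply/eqP.
    by rewrite eq_le -!(ext_group_mono E) k0 raddf0 lexx.
  have [gt|le] := boolP (0 < g); first by exists g.
  have {}le : g < 0 by rewrite lt_neqAle g0 oag_leNgt.
  exists (- g); rewrite lt_neqAle eq_sym oppr_eq0 g0 /=.
  by have := oag_lerD2l (- g) _ _ (ltW le); rewrite addNr addr0.
(* A ball is a pair of center and radius. By density it contains an element of degree above [n], and
   by openness a smaller ball of such elements. *)
have step n (s : L * H) : exists s' : L * H,
    (forall z, vle (Some s'.2) (w (z - s'.1)) -> vle (Some s.2) (w (z - s.1))) /\
    (forall z, vle (Some s'.2) (w (z - s'.1)) -> degree_gt e n z).
  have [y dy ys] := degree_gt_dense unb n s.1 s.2.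
  have [g hg] := degree_gt_open (maximal_image (E := E) mv) t0 dy.
  have [h [h1 h2]] := oag_max g s.2.
  exists (y, h); split=> /= z hz; last by apply: hg; exact: vle_trans hz.
  by rewrite -(subrKA y); apply: val_addge => //; exact: vle_trans hz.
have [f hf] := choice (fun ns : nat * (L * H) => step ns.1 ns.2).
pose s := fix s n := if n is m.+1 then f (m, s m) else (0 : L, 0 : H).
pose ball n z := vle (Some (s n).2) (w (z - (s n).1)).
have ballS n z : ball n.+1 z -> ball n z by have [h _] := hf (n, s n); exact: h.
have ball_deg n z : ball n.+1 z -> degree_gt e n z by have [_ h] := hf (n, s n); exact: h.
have ball_le m n z : (m <= n)%N -> ball n z -> ball m z.
  by move/subnK <-; elim: (n - m)%N => //= k IH /ballS.
have ball_center n : ball n (s n).1 by rewrite /ball subrr val0.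
have [//|n g h|m n|z _ hz] := maximal_spherically_complete mw
  (a := fun n => (s n).1) (U := fun n g => vle (Some (s n).2) g).
- exact: vle_trans.
- have [le|le] := orP (leq_total m n); [left|right].
    by rewrite val_distC; exact: ball_le le (ball_center n).
  exact: ball_le le (ball_center m).
(* [z] lies in every ball, but the ball of index [(size p).+1] contains no root of [p]. *)
have [p p0 pz] := algE z.
by have := ball_deg (size p) z (hz _) p p0 (leqnSn _); rewrite pz.
Qed.

End InfiniteExtension.

Theorem corollary1p3 (K L : fieldType) (G H : oagType)
    (v : valuation K G) (w : valuation L H) (E : valued_extension v w) :
  nontrivial v ->
  maximal v ->
  [pchar K] =i pred0 ->
  algebraic_extension (ext_field E) ->
  maximal w <-> finite_extension (ext_field E).
Proof.
move=> nv mv char0 algE; split=> [mw|]; last exact: finite_extension_maximal.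
apply: finite_of_bounded_degree => //.
exact: bounded_degree_of_maximal mw.
Qed.
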